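(* Let $a(n,m,\Gamma_{sp})$ be the number of single-peaked $(n,m)$-elections on the candidate set $\{c_1,\ldots,c_m\}$. Then (i) $a(2,m,\Gamma_{sp})=m!\binom{2m-2}{m-1}$ for all $m\ge 1$; (ii) $a(n,3,\Gamma_{sp})=6\cdot 2^{n-1}(2^n-1)$ for all $n\ge 1$; (iii) $a(n,4,\Gamma_{sp})=24\cdot 4^{n-1}(2^{n+1}-3)$ for all $n\ge 1$.
   Context: An $(n,m)$-election $(C,\mathcal{P})$ is a set $C$ of $m$ candidates with an ordered $n$-tuple $\mathcal{P}=(V_1,\ldots,V_n)$ of total orders (votes) on $C$ (elections differing only in the order of votes are distinct). Given a total order $A$ on $C$ (an axis), a vote $V$ contains a valley with respect to $A$ on candidates $c_1,c_2,c_3$ if $c_2$ lies strictly between $c_1$ and $c_3$ in $A$ and $V$ ranks $c_2$ below both $c_1$ and $c_3$. The election is single-peaked with respect to $A$ if no vote contains a valley with respect to $A$, and single-peaked if it is single-peaked with respect to some total order $A$ on $C$. *)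

(* Defs.v *)
From mathcomp Require Import all_boot all_fingroup.
Set Implicit Arguments. Unset Strict Implicit. Unset Printing Implicit Defensive.

(* Candidates c_1..c_m are the elements of 'I_m.
   A total order on 'I_m is encoded by its ranking bijection
   s : {perm 'I_m}, where s c is the position of candidate c
   (position 0 = top).  For a vote V, c is ranked above d iff V c < V d.
   For an axis A, A c is the position of c along the axis. *)
Definition total_order (m : nat) := {perm 'I_m}.

Definition election (n m : nat) := {ffun 'I_n -> {perm 'I_m}}.

Definition between m (A : {perm 'I_m}) (c1 c2 c3 : 'I_m) : bool :=
  ((A c1 < A c2) && (A c2 < A c3)) || ((A c3 < A c2) && (A c2 < A c1)).

Definition has_valley m (A V : {perm 'I_m}) : bool :=
  [exists c1 : 'I_m, exists c2 : 'I_m, exists c3 : 'I_m,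
     [&& between A c1 c2 c3, V c1 < V c2 & V c3 < V c2]].

Definition single_peaked_wrt n m (A : {perm 'I_m}) (P : election n m) : bool :=
  [forall i : 'I_n, ~~ has_valley A (P i)].

Definition single_peaked n m (P : election n m) : bool :=
  [exists A : {perm 'I_m}, single_peaked_wrt A P].

Definition a_sp (n m : nat) : nat := #|[pred P : election n m | single_peaked P]|.

(* Main.v *)
Require Import Defs.
From mathcomp Require Import all_boot all_fingroup.
From mathcomp Require Import zify.

Set Implicit Arguments. Unset Strict Implicit. Unset Printing Implicit Defensive.

(** A vote on k+1 candidates is single-peaked with respect to an axis iff, read
    from the bottom, it always takes the leftmost or the rightmost remaining
    candidate of the axis; it is thus encoded by a word of k letters left/right.
    A single-peaked election is therefore an axis with one word per vote, and two
    such descriptions of the same election differ by reversing the remaining part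
    of the axis at moments when all votes have used up the same candidates, that
    is, when all words contain the same number of letters "left" so far.  Asking
    the first vote to go left at each such moment selects exactly one description,
    so that a(n,m) is m! times the number of these canonical families of words.
    For n = 2 they are walks (the difference of the two counts) in bijection with
    nonnegative walks of 2(m-1) steps, hence the central binomial coefficient;
    for m = 3, 4 they are counted letter by letter. *)

(** * Words of letters left/right and the axis positions they take *)

Definition lcount (s : seq bool) (t : nat) : nat := count id (take t s).

Lemma lcount0 s : lcount s 0 = 0.
Proof. by rewrite /lcount take0. Qed.

Lemma lcountS s t : lcount s t.+1 = lcount s t + nth false s t.
Proof.
rewrite /lcount; case: (ltnP t (size s)) => lt_ts.
  by rewrite (take_nth false lt_ts) -cats1 count_cat /= addn0.
by rewrite nth_default // addn0 !take_oversize // ltnW.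
Qed.

Lemma lcount_cons b s t : lcount (b :: s) t.+1 = b + lcount s t.
Proof. by []. Qed.

Lemma lcount_mono s t u : t <= u -> lcount s t <= lcount s u <= lcount s t + (u - t).
Proof.
move=> /subnKC <-; elim: (u - t) => [|d IHd]; first by rewrite addn0; lia.
by rewrite addnS lcountS; case: (nth false s _); lia.
Qed.

Lemma lcount_le s t : lcount s t <= t.
Proof. by have := lcount_mono s (leq0n t); rewrite lcount0; lia. Qed.

(* The axis position taken at time [t], counted from the bottom of the vote.
   Words have [k] letters: the [k]-th one, read as [false], is irrelevant since
   a single position remains. *)
Definition slot (k : nat) (s : seq bool) (t : nat) : nat :=
  if nth false s t then lcount s t else k - (t - lcount s t).

Lemma slot_later k s t u : t < u <= k ->
  lcount s t.+1 <= slot k s u <= k - (t.+1 - lcount s t.+1).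
Proof.
move=> /andP[lt_tu le_uk]; have := lcount_mono s lt_tu.
have := lcount_le s u; have := lcount_le s t.+1.
by rewrite /slot; case: ifP => _; lia.
Qed.

Lemma slot_le k s t : t <= k -> slot k s t <= k.
Proof. by have := lcount_le s t; rewrite /slot; case: ifP => _; lia. Qed.

(** The position taken at time [t] is an end of the interval still free, so all later positions lie
    on one side of it. *)
Lemma slot_ends k s t u : t < u <= k ->
  if nth false s t then slot k s t < slot k s u else slot k s u < slot k s t.
Proof.
move=> tu; have := slot_later s tu; rewrite lcountS.
rewrite (erefl : slot k s t = if nth false s t then _ else _).
by have := lcount_le s t; case: (nth false s t); lia.
Qed.

Lemma slot_inj k s t u : t <= k -> u <= k -> slot k s t = slot k s u -> t = u.
Proof.
move=> le_tk le_uk e; case: (ltngtP t u) => // lt.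
- have := @slot_ends k s t u; rewrite lt le_uk e => /(_ isT).
  by case: ifP; rewrite ltnn.
- have := @slot_ends k s u t; rewrite lt le_tk e => /(_ isT).
  by case: ifP; rewrite ltnn.
Qed.

Lemma slot_consumed k s t x : t <= k ->
  (x < lcount s t) || (k - (t - lcount s t) < x <= k) ->
  exists2 u, u < t & slot k s u = x.
Proof.
elim: t => [|t IHt] lt_tk; first by rewrite lcount0; lia.
rewrite lcountS => hx; have := lcount_le s t => le_ct.
case: (boolP ((x < lcount s t) || (k - (t - lcount s t) < x <= k))) => [hx'|nhx].
  by have [u lt_ut eu] := IHt (ltnW lt_tk) hx'; exists u => //; exact: ltnW.
by exists t => //; rewrite /slot; move: hx nhx; case: (nth false s t); lia.
Qed.

Lemma slot_ord_inj k s :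
  injective (fun t : 'I_k.+1 => inord (slot k s t) : 'I_k.+1).
Proof.
move=> t u /(congr1 val) /=; rewrite !inordK ?ltnS ?slot_le ?leq_ord // => e.
by apply/val_inj/(slot_inj _ _ e); exact: leq_ord.
Qed.

(** * Votes built from words *)

Definition slot_perm (k : nat) (s : seq bool) : {perm 'I_k.+1} :=
  perm (@slot_ord_inj k s).

Lemma slot_permE k s (t : 'I_k.+1) : slot_perm k s t = slot k s t :> nat.
Proof. by rewrite permE inordK // ltnS slot_le // leq_ord. Qed.

Definition rev_perm (k : nat) : {perm 'I_k} := perm (@rev_ord_inj k).

(** Products act from left to right: candidate to axis position, then to the time at which it is
    taken, then to its rank. Time runs from the bottom and ranks from the top, hence [rev_perm]. *)
Definition word_vote (k : nat) (A : {perm 'I_k.+1}) (s : seq bool) :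
  {perm 'I_k.+1} := (A * (slot_perm k s)^-1 * rev_perm k.+1)%g.

Lemma word_voteE k A s c (V := @word_vote k A s) :
  A c = slot k s (k - V c) :> nat.
Proof.
rewrite /V /word_vote !permM [rev_perm _ _]permE /= subSS.
rewrite subKn ?leq_ord // -slot_permE.
by rewrite permKV.
Qed.

(** In a valley the middle candidate is taken before the two others, which [slot_ends] puts on the
    same side of it. *)
Lemma word_vote_no_valley k (A : {perm 'I_k.+1}) s :
  ~~ has_valley A (word_vote A s).
Proof.
set V := word_vote A s.
apply/negP => /existsP[c1 /existsP[c2 /existsP[c3 /and3P[btw lt1 lt3]]]].
have e c : A c = slot k s (k - V c) :> nat by exact: word_voteE.
move: btw; rewrite /between !e.
have b2 : V c2 <= k by rewrite -ltnS.
have b1 : k - V c2 < k - V c1 <= k by lia.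
have b3 : k - V c2 < k - V c3 <= k by lia.
have := slot_ends s b1; have := slot_ends s b3.
by case: (nth false s (k - V c2)); lia.
Qed.

(** * The word of a vote without valley *)

Section WordOfVote.

Variables (k : nat) (A V : {perm 'I_k.+1}).
Hypothesis noval : ~~ has_valley A V.

Let seat (t : nat) : nat := A ((V^-1)%g (inord (k - t))).

Let seat_le t : seat t <= k.
Proof. exact: leq_ord. Qed.

Let seat_inj t u : t <= k -> u <= k -> seat t = seat u -> t = u.
Proof.
move=> le_tk le_uk /val_inj/perm_inj/perm_inj/(congr1 val).
by rewrite /= !inordK; lia.
Qed.

Let seat_peak t u v : t < u <= k -> t < v <= k ->
  seat u < seat t -> seat t < seat v -> False.
Proof.
move=> tu tv lt1 lt2; case/negP: noval.
apply/existsP; exists ((V^-1)%g (inord (k - u))).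
apply/existsP; exists ((V^-1)%g (inord (k - t))).
apply/existsP; exists ((V^-1)%g (inord (k - v))).
by rewrite /between lt1 lt2 !permKV !inordK /=; lia.
Qed.

Let word : k.-tuple bool :=
  [tuple [forall u : 'I_k.+1, (i < u) ==> (seat i < seat u)] | i < k].

Let nth_word t : t < k ->
  nth false word t = [forall u : 'I_k.+1, (t < u) ==> (seat t < seat u)].
Proof. by move=> lt_tk; rewrite -(tnth_nth false word (Ordinal lt_tk)) tnth_mktuple. Qed.

Let free_range t x : t <= k ->
  (lcount word t <= x <= k - (t - lcount word t)) <->
  (exists2 u, t <= u <= k & seat u = x).
Proof.
elim: t x => [|t IHt] x lt_tk.
  rewrite lcount0; split=> [/= hx|[u _ <-]]; last by have := seat_le u; lia.
  exists (k - V ((A^-1)%g (inord x))); first by lia.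
  rewrite /seat subKn ?leq_ord // inord_val permK permKV inordK //; lia.
have lt_tk' := ltnW lt_tk.
have le_ct := lcount_le word t; set c := lcount word t in le_ct IHt *.
have seat_in : c <= seat t <= k - (t - c).
  by apply/(IHt _ lt_tk'); exists t => //; lia.
have later x' : c <= x' <= k - (t - c) -> x' != seat t ->
    exists2 u, t < u <= k & seat u = x'.
  move=> /(IHt _ lt_tk')[u hu eu] ne; exists u => //.
  have : t != u by apply: contraNneq ne => ->; rewrite eu.
  by lia.
(* If the letter is left, all later seats are to the right, so the left end cannot be still to come.
   Otherwise some later seat is to the left, and a right end still to come would make a valley. *)
have seat_end : seat t = if nth false word t then c else k - (t - c).
  rewrite nth_word //; case: ifP => [/forallP fa|/negbT].
    apply/eqP; rewrite eqn_leq; case/andP: (seat_in) => -> _; rewrite andbT.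
    rewrite leqNgt; apply/negP => lt.
    have [||u hu eu] := later c; [by lia|by lia|].
    have hu' : u < k.+1 by lia.
    have := fa (Ordinal hu'); rewrite /= eu; lia.
  rewrite negb_forall => /existsP[u]; rewrite negb_imply -leqNgt => /andP[lt_tu le].
  have hu : t < u <= k by rewrite lt_tu -ltnS ltn_ord.
  have lt : seat u < seat t.
    rewrite ltn_neqAle le andbT; apply/eqP => e.
    by have := seat_inj (proj2 (andP hu)) lt_tk' e; lia.
  apply/eqP; rewrite eqn_leq; case/andP: (seat_in) => _ -> /=.
  rewrite leqNgt; apply/negP => lt2.
  have [||v hv ev] := later (k - (t - c)); [by lia|by lia|].
  by apply: (seat_peak hu hv lt); rewrite ev.
have step : (lcount word t.+1 <= x <= k - (t.+1 - lcount word t.+1)) =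
    (c <= x <= k - (t - c)) && (x != seat t).
  by rewrite lcountS -/c seat_end; case: (nth false word t); lia.
rewrite step; split=> [/andP[]|[u hu <-]]; first exact: later.
apply/andP; split; first by apply/(IHt _ lt_tk'); exists u => //; lia.
by apply/eqP => /seat_inj; lia.
Qed.

Let seat_slot t : t <= k -> seat t = slot k word t.
Proof.
move=> le_tk; have le_ct := lcount_le word t.
have : lcount word t <= seat t <= k - (t - lcount word t).
  by apply/(free_range _ le_tk); exists t; rewrite ?leqnn.
(* At time [k] the default letter [false] is read, and a single position is free. *)
case: (ltngtP t k) le_tk => // [lt_tk _|->]; last first.
  by rewrite /slot nth_default ?size_tuple //; have := lcount_le word k; lia.
(* For [t < k] the seat is free at [t] but not at [t.+1], so it is the end that the letter
   removes. *)
move=> h; have : ~ exists2 u, t.+1 <= u <= k & seat u = seat t.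
  by case=> u hu /seat_inj; lia.
rewrite -(free_range _ lt_tk) lcountS /slot.
by case: (nth false word t); lia.
Qed.

Lemma no_valley_word : exists s : k.-tuple bool, V = word_vote A s.
Proof.
exists word; apply/permP => c; apply/val_inj.
have := word_voteE A word c; set V' := word_vote A word => e.
have : seat (k - V c) = A c by rewrite /seat subKn ?leq_ord // inord_val permK.
rewrite e seat_slot ?leq_subr // => /slot_inj.
rewrite !leq_subr => /(_ isT isT).
have := ltn_ord (V c); have := ltn_ord (V' c); rewrite /=; lia.
Qed.

End WordOfVote.

(** * Elections as families of words, and uniqueness of canonical families *)

(* The letters of all votes at a given time; [true] means left. *)
Definition column (n : nat) := {ffun 'I_n.+1 -> bool}.

Definition row_word (n : nat) (W : seq (column n)) (j : 'I_n.+1) : seq bool :=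
  [seq (X : column n) j | X <- W].

Definition const_state (n : nat) (st : 'I_n.+1 -> nat) : bool :=
  [forall j, st j == st ord0].

(* [st j] is the number of letters [true] already read in the word of vote [j]. *)
Fixpoint canonical (n : nat) (st : 'I_n.+1 -> nat) (W : seq (column n)) : bool :=
  if W is X :: W' then
    (const_state st ==> X ord0) && canonical (fun j => st j + X j) W'
  else true.

Lemma canonicalP n st (W : seq (column n)) :
  reflect (forall t, t < size W ->
             const_state (fun j => st j + lcount (row_word W j) t) ->
             nth false (row_word W ord0) t)
          (canonical st W).
Proof.
have cst st1 st2 : st1 =1 st2 -> @const_state n st1 = const_state st2.
  by move=> e; apply: eq_forallb => j; rewrite !e.
elim: W st => [|X W IHW] st /=; first by left.
apply: (iffP andP) => [[/implyP h0 /IHW h] [|t] //= lt|h].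
- by rewrite (cst _ st) // => j; rewrite addn0.
- rewrite (cst _ (fun j => st j + X j + lcount (row_word W j) t)) => [|j].
    exact: h.
  by rewrite lcount_cons addnA.
split.
  by apply/implyP => h0; apply: (h 0) => //; rewrite (cst _ st) // => j; rewrite addn0.
apply/IHW => t lt h0; apply: (h t.+1) => //.
by rewrite (cst _ (fun j => st j + X j + lcount (row_word W j) t)) // => j;
  rewrite lcount_cons addnA.
Qed.

Definition word_election n k (A : {perm 'I_k.+1}) (W : seq (column n)) :
  election n.+1 k.+1 := [ffun j => word_vote A (row_word W j)].

Lemma row_word_inj n k (W U : k.-tuple (column n)) :
  (forall j, row_word W j = row_word U j) -> W = U.
Proof.
move=> e; apply: eq_from_tnth => i; apply/ffunP => j.
have := congr1 (fun s => nth false s i) (e j).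
pose X0 : column n := [ffun=> false].
by rewrite !(nth_map X0) ?size_tuple // -!tnth_nth.
Qed.

Lemma eq_lcount s s' t : (forall u, u < t -> nth false s u = nth false s' u) ->
  lcount s t = lcount s' t.
Proof.
elim: t => [|t IHt] e; first by rewrite !lcount0.
by rewrite !lcountS e // IHt // => u lt; apply: e; exact: ltnW.
Qed.

(* Going up the votes, the part of the axis already used by some vote is fixed
   by the permutation taking one axis to the other; unless all votes have used
   the same part, one of the two ends facing a given vote is thus fixed, and
   this decides its next letter. *)
Lemma word_election_inj n k (A B : {perm 'I_k.+1}) (W U : k.-tuple (column n)) :
  canonical (fun=> 0) W -> canonical (fun=> 0) U ->
  word_election A W = word_election B U -> A = B /\ W = U.
Proof.
move=> /canonicalP cW /canonicalP cU eAB.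
have eperm j : (A * (slot_perm k (row_word W j))^-1 =
                B * (slot_perm k (row_word U j))^-1)%g.
  by move/ffunP/(_ j): eAB; rewrite !ffunE => /mulIg.
(* [pi] sends the position of a candidate along [A] to its position along [B]. *)
pose pi := (A^-1 * B)%g.
have key j t : t <= k ->
    slot k (row_word U j) t = pi (inord (slot k (row_word W j) t)).
  move=> le_tk; have lt_tk : t < k.+1 by [].
  rewrite -[LHS](slot_permE _ (Ordinal lt_tk)).
  have -> : slot_perm k (row_word U j) = (slot_perm k (row_word W j) * pi)%g.
    by rewrite /pi mulgA -[X in (X * _)%g]invgK invMg invgK eperm invMg invgK mulgKV.
  rewrite permM; congr (val (pi _)); apply/val_inj.
  by rewrite /= slot_permE inordK // ltnS slot_le.
have letters t : t < k -> forall j,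
    nth false (row_word U j) t = nth false (row_word W j) t.
  elim/ltn_ind: t => t IHt lt_tk.
  pose l j := lcount (row_word W j) t.
  have le_l j : l j <= t by exact: lcount_le.
  have eU u j : u <= t -> lcount (row_word U j) u = lcount (row_word W j) u.
    by move=> le; apply: eq_lcount => v lt; apply: IHt; lia.
  have eslot u j : u < t -> slot k (row_word U j) u = slot k (row_word W j) u.
    by move=> lt; rewrite /slot eU ?IHt //; lia.
  have consumed j x : (x < l j) || (k - (t - l j) < x <= k) ->
      pi (inord x) = x :> nat.
    move=> /(slot_consumed (ltnW lt_tk))[u lt_ut <-].
    by rewrite -key ?eslot //; lia.
  (* As [t < k], the two ends facing vote [j] differ. Since [pi] sends the end taken under [W] to
     the end taken under [U], fixing either one forces equal letters. *)
  have pick j : pi (inord (l j)) = l j :> nat \/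
      pi (inord (k - (t - l j))) = k - (t - l j) :> nat ->
      nth false (row_word U j) t = nth false (row_word W j) t.
    have le := le_l j; have := key j t (ltnW lt_tk); rewrite /slot eU // -/(l j).
    have pi_neq : pi (inord (l j)) <> pi (inord (k - (t - l j))) :> nat.
      move/val_inj/perm_inj/(congr1 val).
      by rewrite /= !inordK; lia.
    by case: (nth false (row_word U j) t) (nth false (row_word W j) t) => [] [] //; lia.
  (* When all counts agree, canonicity makes the first vote go left in both families, so [pi] fixes
     the left end, which is common to all votes. *)
  have [/forallP cl | ] := boolP (const_state l).
    have W0 : nth false (row_word W ord0) t.
      by apply: cW; rewrite ?size_tuple //; apply/forallP => j; exact: cl.
    have U0 : nth false (row_word U ord0) t.
      apply: cU; rewrite ?size_tuple //; apply/forallP => j.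
      by rewrite !eU //; exact: cl.
    have := key ord0 t (ltnW lt_tk); rewrite /slot W0 U0 eU // -/(l _) => fix0 j.
    by apply: pick; left; rewrite (eqP (cl j)) -fix0.
  rewrite negb_forall => /existsP[j1 ne1] j.
  have [j2 ne2] : exists j2, l j2 != l j.
    by case: (eqVneq (l j1) (l j)) => [e|]; [exists ord0; rewrite -e eq_sym | exists j1].
  have := le_l j; have := le_l j2 => le2 le1.
  apply: pick; case: (ltngtP (l j) (l j2)) => lt; last by rewrite lt eqxx in ne2.
    by left; apply: (consumed j2); rewrite lt.
  by right; apply: (consumed j2); lia.
have eWU : W = U.
  apply: row_word_inj => j; apply: (@eq_from_nth _ false).
    by rewrite !size_map !size_tuple.
  by move=> t; rewrite size_map size_tuple => lt; rewrite letters.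
by split=> //; move: (eperm ord0); rewrite eWU => /mulIg.
Qed.

(** * Reversing the remaining part of the axis *)

Definition flip (t : nat) (s : seq bool) : seq bool :=
  take t s ++ map negb (drop t s).

Lemma nth_flip t s u : u < size s ->
  nth false (flip t s) u = (u < t) (+) ~~ nth false s u.
Proof.
move=> lt_us; rewrite nth_cat size_take_min.
case: (ltnP u t) => [lt_ut|le_tu]; first by rewrite leq_min lt_ut lt_us nth_take //= negbK.
rewrite ltnNge geq_min le_tu /= (minn_idPl _); last by lia.
by rewrite (nth_map false) ?size_drop ?nth_drop ?subnKC //; lia.
Qed.

Lemma lcount_flip_before t s u : u <= t -> lcount (flip t s) u = lcount s u.
Proof.
move=> le_ut; apply: eq_lcount => v lt_vu.
case: (ltnP v (size s)) => lt_vs; first by rewrite nth_flip // (leq_trans lt_vu) //= negbK.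
rewrite !nth_default // size_cat size_map size_take_min size_drop; lia.
Qed.

Lemma lcount_flip_after t s u : t <= u <= size s ->
  lcount (flip t s) u + lcount s u = (lcount s t).*2 + (u - t).
Proof.
case/andP=> /subnKC <-; elim: (u - t) => [|d IHd] le.
  by rewrite addn0 lcount_flip_before //; lia.
rewrite addnS !lcountS nth_flip ?ltnNge ?leq_addr /=; last by lia.
have := IHd; case: (nth false s _); lia.
Qed.

(** Swapping left and right from time [t] on reflects the interval free at [t], while positions
    taken before stay put. *)
Lemma slot_flip k t s u (l := lcount s t) (r := k - (t - l)) :
  size s = k -> t <= k -> u <= k ->
  slot k (flip t s) u =
    if l <= slot k s u <= r then l + r - slot k s u else slot k s u.
Proof.
move=> sz le_tk le_uk; have := lcount_le s t; have := lcount_le s u.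
rewrite -/l => cu cl; case: (ltnP u t) => [lt_ut | le_tu].
  have := lcount_mono s lt_ut; rewrite lcountS -/l.
  rewrite /slot (lcount_flip_before _ (ltnW lt_ut)) nth_flip; last by lia.
  by rewrite lt_ut /= negbK; case: (nth false s u); case: ifP; rewrite /r; lia.
have := @lcount_flip_after t s u; rewrite le_tu sz le_uk => /(_ isT); rewrite -/l.
have := lcount_mono s le_tu; rewrite -/l /slot.
have := lcount_le (flip t s) u.
case: (ltngtP u k) le_uk => // [lt_uk|->] _.
  rewrite nth_flip ?sz // ltnNge le_tu /=.
  by case: (nth false s u); case: ifP; rewrite /r /=; lia.
(* At [u = k] both words give the default [false], which is not negated; the counts alone yield the
   reflected position. *)
rewrite !nth_default ?sz //; last first.
  by rewrite size_cat size_map size_take_min size_drop; lia.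
by case: ifP; rewrite /r /=; lia.
Qed.

Definition flip_columns n (t : nat) (W : seq (column n)) : seq (column n) :=
  take t W ++ [seq [ffun j => ~~ X j] | X : column n <- drop t W].

Lemma row_word_flip n t (W : seq (column n)) j :
  row_word (flip_columns t W) j = flip t (row_word W j).
Proof.
rewrite /row_word /flip map_cat -map_take -map_drop -!map_comp.
by congr (_ ++ _); apply: eq_map => X /=; rewrite ffunE.
Qed.

(** Equal counts at time [t] mean the same free interval for all votes, so one reflection [rho] of
    positions serves them all and is absorbed into the axis. *)
Lemma word_election_flip n k t (A : {perm 'I_k.+1}) (W : seq (column n)) :
  size W = k -> t <= k -> const_state (fun j => lcount (row_word W j) t) ->
  exists A', word_election A' (flip_columns t W) = word_election A W.
Proof.
move=> szW le_tk /forallP cl.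
pose sg j := slot_perm k (row_word W j).
pose sg' j := slot_perm k (row_word (flip_columns t W) j).
pose rho := ((sg ord0)^-1 * sg' ord0)%g.
have sg'E j x : sg' j x = (let l := lcount (row_word W ord0) t in
    let r := k - (t - l) in
    if l <= sg j x <= r then l + r - sg j x else sg j x) :> nat.
  rewrite /= /sg' /sg !slot_permE row_word_flip slot_flip ?size_map ?leq_ord //.
  by rewrite (eqP (cl j)).
have sgE j : sg' j = (sg j * rho)%g.
  apply/permP => x; apply/val_inj.
  by rewrite /= permM /rho permM !sg'E permKV.
clearbody rho; exists (A * rho)%g; apply/ffunP => j; rewrite !ffunE /word_vote.
by rewrite -[slot_perm k (row_word (flip_columns _ _) _)]/(sg' j) sgE invMg !mulgA mulgK.
Qed.

(** Times are repaired in increasing order: a flip at [t] corrects the letter of the first vote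
    there and changes no earlier letter. *)
Lemma canonical_word_election n k (A : {perm 'I_k.+1}) (W : k.-tuple (column n)) :
  exists A', exists2 W' : k.-tuple (column n), canonical (fun=> 0) W' &
    word_election A' W' = word_election A W.
Proof.
pose good t (U : seq (column n)) :=
  const_state (fun j => lcount (row_word U j) t) -> nth false (row_word U ord0) t.
suff main t : t <= k -> exists A', exists2 W' : seq (column n), size W' = k &
    (forall u, u < t -> good u W') /\ word_election A' W' = word_election A W.
  have [A' [W' szW' [h e]]] := main k (leqnn k).
  exists A'; exists (Tuple (introT eqP szW')) => //.
  by apply/canonicalP => t /=; rewrite szW' => /h.
elim: t => [|t IHt] le_tk; first by exists A, W; rewrite ?size_tuple.
have [A' [W' szW' [h e]]] := IHt (ltnW le_tk).
have [ht|] := boolP (const_state (fun j => lcount (row_word W' j) t)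
    ==> nth false (row_word W' ord0) t).
  exists A'; exists W' => //; split=> // u; rewrite ltnS leq_eqVlt => /orP[/eqP->|/h//].
  exact: implyP.
rewrite negb_imply => /andP[cst nlet].
have [A2 e2] := word_election_flip A' szW' (ltnW le_tk) cst.
exists A2; exists (flip_columns t W').
  by rewrite size_cat size_map size_take_min size_drop; lia.
split=> [u lt_ut1|]; last by rewrite e2.
rewrite /good row_word_flip nth_flip ?size_map ?szW'; last by lia.
have [lt_ut|le_tu] := ltnP u t; last first.
  by have -> : u = t by lia; rewrite nlet.
rewrite /= negbK => /forallP c; apply: (h u lt_ut); apply/forallP => j.
by have := c j; rewrite !row_word_flip !lcount_flip_before // ltnW.
Qed.

(** * Reduction to counting canonical families *)

Lemma single_peaked_word n k (P : election n.+1 k.+1) :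
  reflect (exists A, exists W : k.-tuple (column n), P = word_election A W)
          (single_peaked P).
Proof.
apply: (iffP existsP) => [[A /forallP h]|[A [W ->]]]; exists A; last first.
  by apply/forallP => j; rewrite ffunE word_vote_no_valley.
have [s es] := fin_all_exists (fun j => no_valley_word (h j)).
exists [tuple [ffun j => tnth (s j) i] | i < k]; apply/ffunP => j.
rewrite ffunE es; congr word_vote; apply: (@eq_from_nth _ false).
  by rewrite size_map !size_tuple.
move=> t; rewrite size_tuple => lt_tk.
pose X0 : column n := [ffun=> false]; rewrite (nth_map X0) ?size_tuple //.
by rewrite -(tnth_nth X0 _ (Ordinal lt_tk)) tnth_mktuple ffunE (tnth_nth false).
Qed.

Lemma a_sp_canonical n k :
  a_sp n.+1 k.+1 =
    k.+1`! * #|[pred W : k.-tuple (column n) | canonical (fun=> 0) W]|.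
Proof.
pose D := setX [set: {perm 'I_k.+1}] [set W : k.-tuple (column n) | canonical (fun=> 0) W].
pose f (p : {perm 'I_k.+1} * k.-tuple (column n)) := word_election p.1 p.2.
have <- : #|f @: D| = a_sp n.+1 k.+1.
  apply: eq_card => P; rewrite inE; apply/imsetP/single_peaked_word.
    by case=> [[A W] _ ->]; exists A, W.
  case=> A [W ->]; have [A' [W' cW' e]] := canonical_word_election A W.
  by exists (A', W'); rewrite ?inE.
rewrite card_in_imset => [|[A W] [B U]]; last first.
  rewrite !inE /= => cW cU e.
  by have [/= -> ->] := word_election_inj cW cU e.
by rewrite cardsX cardsT card_Sn; congr (_ * _); apply: eq_card => W; rewrite !inE.
Qed.

Fixpoint ncanon (n k : nat) (st : 'I_n.+1 -> nat) : nat :=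
  if k is k'.+1 then
    \sum_(X : column n | const_state st ==> X ord0) ncanon k' (fun j => st j + X j)
  else 1.

Lemma card_canonical n k st :
  #|[pred W : k.-tuple (column n) | canonical st W]| = ncanon k st.
Proof.
elim: k st => [|k IHk] st /=.
  rewrite (eq_card (_ : _ =i predT)) ?card_tuple // => W.
  by rewrite !inE tuple0.
rewrite -sum1_card (reindex (fun p : column n * k.-tuple (column n) => cons_tuple p.1 p.2)) /=.
  rewrite -(pair_big_dep (fun X : column n => const_state st ==> X ord0)
    (fun X (W : k.-tuple _) => canonical (fun j => st j + X j) W) (fun _ _ => 1)) /=.
  by apply: eq_bigr => X _; rewrite -IHk -sum1_card.
exists (fun W => (thead W, behead_tuple W)) => [[X W] _ | W _] /=.
  by congr pair; apply/val_inj.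
by rewrite [RHS]tuple_eta; apply/val_inj.
Qed.

(** * Two votes and the central binomial coefficient *)

Definition column2 (b c : bool) : column 1 := [ffun j => if j == ord0 then b else c].

Lemma sum_column2 (F : column 1 -> nat) :
  \sum_X F X = F (column2 true true) + F (column2 true false) +
               (F (column2 false true) + F (column2 false false)).
Proof.
rewrite (reindex (fun p : bool * bool => column2 p.1 p.2)) /=.
  by rewrite -(pair_bigA _ (fun b c => F (column2 b c))) big_bool !big_bool.
exists (fun X : column 1 => (X ord0, X ord_max)) => [[b c] _|X _] /=.
  by rewrite !ffunE.
by apply/ffunP => j; rewrite ffunE; case: (unliftP ord0 j) => [i|] -> //;
  rewrite ord1; congr (X _); apply/val_inj.
Qed.

(* The number of walks of [2 * k] steps +1 or -1 from height [2 * d] that stay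
   nonnegative, in the form given by the reflection principle. *)
Definition ballot (k d : nat) : nat :=
  'C(2 * k, k) + 2 * \sum_(i < d) 'C(2 * k, k + i.+1).

Lemma ballotS k d : ballot k d.+1 = ballot k d + 2 * 'C(2 * k, k + d.+1).
Proof. by rewrite /ballot big_ord_recr /= mulnDr addnA. Qed.

Lemma ballot0 k : ballot k 0 = 'C(2 * k, k).
Proof. by rewrite /ballot big_ord0 muln0 addn0. Qed.

Lemma bin_step2 k i : 'C(2 * k.+1, k.+1 + i.+1) =
  'C(2 * k, k + i.+2) + 2 * 'C(2 * k, k + i.+1) + 'C(2 * k, k + i).
Proof.
by rewrite mulnS add2n addSn !binS !addnS !binS; lia.
Qed.

Lemma ballot_rec0 k : ballot k.+1 0 = ballot k 0 + ballot k 1.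
Proof.
rewrite ballotS !ballot0 mulnS add2n !binS addn1.
(* The symmetry fails at [k = 0], where the truncated [k.-1] gives 1 on the left and 0 on the
   right. *)
have : 'C(2 * k, k.-1) = 'C(2 * k, k.+1) \/ k = 0.
  by case: k => [|k]; [right|left; rewrite -bin_sub; [congr 'C(_, _)|]; lia].
case: k => [|k] /=; first by rewrite muln0.
by rewrite binS; case=> [->|//]; lia.
Qed.

Lemma ballot_recS k d :
  ballot k.+1 d.+1 = ballot k d.+2 + 2 * ballot k d.+1 + ballot k d.
Proof.
elim: d => [|d IHd].
  by rewrite ballotS ballot_rec0 !ballotS bin_step2 ballot0 addn0; lia.
by rewrite ballotS IHd !ballotS bin_step2; lia.
Qed.

(** Here [d] is the lead of the first vote in letters left. A column is two steps of a walk at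
    height [2 * d]: up if the first vote goes left, then up if the second goes right. The canonical
    rule forbids a first step down from height 0, so the walk stays nonnegative. *)
Lemma ncanon2_ballot k (st : 'I_2 -> nat) d :
  st ord0 = st ord_max + d -> ncanon k st = ballot k d.
Proof.
elim: k st d => [|k IHk] st d e /=.
  by rewrite /ballot big1 // => i _; rewrite bin_small.
have -> : const_state st = (d == 0).
  apply/forallP/eqP => [/(_ ord_max)|d0 j]; first by rewrite e; lia.
  case: (unliftP ord0 j) => [i|] -> //; rewrite ord1.
  by rewrite (_ : lift _ _ = ord_max) ?e ?d0 ?addn0 //; apply/val_inj.
rewrite big_mkcond sum_column2 !ffunE /= !implybT.
case: d e => [|d] e /=.
  by rewrite (IHk _ 0) ?(IHk _ 1) ?ballot_rec0 ?ffunE /=; lia.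
by rewrite (IHk _ d.+1) 1?(IHk _ d.+2) 1?(IHk _ d) 1?(IHk _ d.+1) ?ballot_recS ?ffunE /=; lia.
Qed.

(** * Three and four candidates, any number of votes *)

Section ShortWords.

Variable n : nat.
Implicit Types (X Y : column n) (st : 'I_n.+1 -> nat).

Let ones : column n := [ffun=> true].
Let compl X : column n := [ffun j => ~~ X j].

Lemma card_column : #|{: column n}| = 2 ^ n.+1.
Proof. by rewrite card_ffun card_bool card_ord. Qed.

Lemma card_column0 : #|[pred X : column n | X ord0]| = 2 ^ n.
Proof.
have complK : involutive compl by move=> X; apply/ffunP => j; rewrite !ffunE negbK.
have e : #|[pred X : column n | ~~ X ord0]| = #|[pred X : column n | X ord0]|.
  rewrite -!sum1_card (reindex_inj (inv_inj complK)) /=.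
  by apply: eq_bigl => X; rewrite !inE ffunE negbK.
have := cardC [pred X : column n | X ord0].
rewrite card_column [X in _ + X]e expnS addnn -mul2n => /eqP.
by rewrite eqn_pmul2l // => /eqP.
Qed.

Lemma ncanon1 st : ncanon 1 st = if const_state st then 2 ^ n else 2 ^ n.+1.
Proof.
rewrite /= sum_nat_const muln1; case: (const_state st) => /=.
  exact: card_column0.
by rewrite -card_column.
Qed.

(** Of the [2 ^ n] first columns allowed, only [ones] keeps the counts equal, which halves the
    choices for the last column. *)
Lemma ncanon2_const st : const_state st ->
  ncanon 2 st + 2 ^ n = 2 ^ n * 2 ^ n.+1.
Proof.
move=> cst0; have /forallP cst := cst0.
have cstX X : X ord0 -> const_state (fun j => st j + X j) = (X == ones).
  move=> X0; apply/forallP/eqP => [h|-> j]; last first.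
    by rewrite !ffunE eqn_add2r; exact: cst.
  apply/ffunP => j; have := h j; rewrite X0 ffunE (eqP (cst j)).
  by case: (X j) => //; lia.
have -> : ncanon 2 st =
    \sum_(X : column n | X ord0) ncanon 1 (fun j => st j + X j).
  by apply: eq_bigl => X; rewrite cst0.
have ones0 : ones ord0 by rewrite ffunE.
have -> : 2 ^ n * 2 ^ n.+1 = \sum_(X : column n | X ord0) 2 ^ n.+1.
  by rewrite sum_nat_const card_column0.
rewrite (bigD1 ones) // [RHS](bigD1 ones) // ncanon1 cstX // eqxx.
rewrite (eq_bigr (fun=> 2 ^ n.+1)) => [|X /andP[X0 ne]].
  by rewrite addnAC addnn -mul2n -expnS.
by rewrite ncanon1 cstX // (negbTE ne).
Qed.

(** From unequal counts every column is allowed, and only [compl X] makes the counts equal again. *)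
Lemma ncanon2_nonconst st X : const_state st -> X ord0 -> X != ones ->
  ncanon 2 (fun j => st j + X j) + 2 ^ n = 2 ^ n.+1 * 2 ^ n.+1.
Proof.
move=> /forallP cst X0 ne.
have [j1 Xj1] : exists j, ~~ X j.
  apply/existsP; rewrite -negb_forall; apply: contra ne => /forallP h.
  by apply/eqP/ffunP => j; rewrite h ffunE.
have nc : const_state (fun j => st j + X j) = false.
  apply/forallP => /(_ j1); rewrite (eqP (cst j1)) X0 (negbTE Xj1); lia.
(* Votes [ord0] and [j1] differ by one, so equality forces [Y ord0] false and [Y j1] true; each vote
   must then have gained exactly one letter left. *)
have cstY Y : const_state (fun j => st j + X j + Y j) = (Y == compl X).
  apply/forallP/eqP => [h|-> j]; last first.
    by rewrite !ffunE (eqP (cst j)); case: (X j); case: (X ord0); lia.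
  have := h j1; rewrite (eqP (cst j1)) X0 (negbTE Xj1) => h1.
  apply/ffunP => j; have := h j; rewrite ffunE (eqP (cst j)) X0.
  by move: h1; case: (Y j1) (Y ord0) (X j) (Y j) => [] [] [] []; lia.
have -> : ncanon 2 (fun j => st j + X j) =
    \sum_(Y : column n) ncanon 1 (fun j => st j + X j + Y j).
  by apply: eq_bigl => Y; rewrite nc.
have -> : 2 ^ n.+1 * 2 ^ n.+1 = \sum_(Y : column n) 2 ^ n.+1.
  by rewrite sum_nat_const card_column.
rewrite (bigD1 (compl X)) // [RHS](bigD1 (compl X)) // ncanon1 cstY eqxx.
rewrite (eq_bigr (fun=> 2 ^ n.+1)) => [|Y ne'].
  by rewrite addnAC addnn -mul2n -expnS.
by rewrite ncanon1 cstY (negbTE ne').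
Qed.

(** Split on the first column: after [ones] the counts are equal, after each of the other
    [2 ^ n - 1] allowed columns they are not. *)
Lemma ncanon3_const st : const_state st ->
  ncanon 3 st + 3 * 4 ^ n = 4 ^ n * 2 ^ n.+2.
Proof.
move=> cst.
have -> : ncanon 3 st =
    \sum_(X : column n | X ord0) ncanon 2 (fun j => st j + X j).
  by apply: eq_bigl => X; rewrite cst.
have ones0 : ones ord0 by rewrite ffunE.
have card_ne : #|[pred X : column n | X ord0 & X != ones]| = 2 ^ n - 1.
  rewrite -card_column0 [in RHS](cardD1 ones) inE ones0 addKn.
  by apply: eq_card => X; rewrite !inE andbC.
rewrite (bigD1 ones) //.
rewrite (eq_bigr (fun=> 2 ^ n.+1 * 2 ^ n.+1 - 2 ^ n)) => [|X /andP[X0 ne]]; last first.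
  by rewrite -(ncanon2_nonconst cst X0 ne) addnK.
rewrite sum_nat_const card_ne.
have cst1 : const_state (fun j => st j + ones j).
  by apply/forallP => j; rewrite !ffunE eqn_add2r; exact: (forallP cst).
have := ncanon2_const cst1; set N := ncanon 2 _.
rewrite !expnS (expnMn 2 2 n : 4 ^ n = _).
have : 0 < 2 ^ n by rewrite expn_gt0.
move: (2 ^ n) => [|p] // _ hN; rewrite subn1 /=; nia.
Qed.

End ShortWords.

Lemma const_state0 n : @const_state n (fun=> 0).
Proof. by apply/forallP. Qed.

Theorem mainTheorem8 :
  (forall m : nat, 1 <= m -> a_sp 2 m = m`! * 'C((2 * m - 2), (m - 1))) /\
  (forall n : nat, 1 <= n -> a_sp n 3 = 6 * 2 ^ (n - 1) * (2 ^ n - 1)) /\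
  (forall n : nat, 1 <= n -> a_sp n 4 = 24 * 4 ^ (n - 1) * (2 ^ n.+1 - 3)).
Proof.
split=> [[|k] // _|]; last split=> [] [|n] // _.
- rewrite a_sp_canonical card_canonical (@ncanon2_ballot _ _ 0) // ballot0.
  by congr (_ * 'C(_, _)); lia.
- rewrite a_sp_canonical card_canonical subSS subn0 -mulnA; congr (_ * _).
  have := ncanon2_const (const_state0 n); rewrite mulnBr muln1; lia.
rewrite a_sp_canonical card_canonical subSS subn0 -mulnA; congr (_ * _).
have := ncanon3_const (const_state0 n); rewrite mulnBr; lia.
Qed.
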